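(* Every periodic configuration $\omega\in\mathcal{X}(\mathbb{A})$ satisfies $\frac17\le\delta(\omega)\le\frac13$. There are exactly $3$ periodic configurations in $\mathcal{X}(\mathbb{A})$ with density $\frac13$ and exactly $14$ periodic configurations in $\mathcal{X}(\mathbb{A})$ with density $\frac17$.
   Context: $\mathbb{A}$ is the triangular lattice $\{x\mathbf{b}_1+y\mathbf{b}_2:x,y\in\mathbb{Z}\}$, $\mathbf{b}_1=(1,0)$, $\mathbf{b}_2=(\tfrac12,\tfrac{\sqrt3}2)$, sites labeled by coordinates $(x,y)$, two sites adjacent iff at Euclidean distance $1$. $\mathcal{X}(\mathbb{A})$ is the set of $\omega\in\{0,1\}^{\mathbb{A}}$ whose support is a maximal independent set of $\mathbb{A}$. A configuration $\omega$ is periodic if there is a nonzero $v\in\mathbb{A}$ with $\omega_i=\omega_{i+v}$ for all $i\in\mathbb{A}$. Its density is $\delta(\omega)=\lim_{n\to\infty}|\omega_{\Lambda_n}|/|\Lambda_n|$, where $\Lambda_n=\{1,\dots,n\}^2$ and $|\omega_{\Lambda_n}|$ is the number of occupied sites (ones) of $\omega$ in $\Lambda_n$.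
   Formalization: With one nonzero period the density may not exist and infinitely many configurations have density 1/3; so the bounds are stated for one period when the density exists, and existence of the density and the counts 3 and 14 are for configurations with two linearly independent periods. *)

(* Defs.v *)
From HB Require Import structures.
From mathcomp Require Import all_boot all_order all_algebra.
From mathcomp Require Import all_classical all_reals all_analysis.

Set Implicit Arguments.
Unset Strict Implicit.
Unset Printing Implicit Defensive.

Import Order.TTheory GRing.Theory Num.Theory.
Import numFieldNormedType.Exports.

Local Open Scope classical_set_scope.
Local Open Scope ring_scope.

(* A site of the triangular lattice, given by its coordinates (x, y) in the
   basis b1, b2; translations are the additive group structure of int * int. *)
Notation site := (int * int)%type.

Definition b1 (R : realType) : 'rV[R]_2 := \row_j [:: 1; 0]`_j.
Definition b2 (R : realType) : 'rV[R]_2 :=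
  \row_j [:: 1 / 2; Num.sqrt 3 / 2]`_j.

Definition point_of (R : realType) (s : site) : 'rV[R]_2 :=
  s.1%:~R *: b1 R + s.2%:~R *: b2 R.

(* The library norm on 'rV[R]_n is the sup norm, hence this definition. *)
Definition eucl_dist (R : realType) (n : nat) (p q : 'rV[R]_n) : R :=
  Num.sqrt (\sum_(j < n) (p 0 j - q 0 j) ^+ 2).

Definition adjacent (R : realType) (s t : site) : Prop :=
  eucl_dist (point_of R s) (point_of R t) = 1.

Definition independent (R : realType) (A : set site) : Prop :=
  forall s t, A s -> A t -> ~ adjacent R s t.

Definition maximal_independent (R : realType) (A : set site) : Prop :=
  independent R A /\
  forall B : set site, independent R B -> A `<=` B -> B = A.

Definition config := site -> bool.

Definition max_indep_configs (R : realType) : set config :=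
  [set w | maximal_independent R [set s | w s]].

Definition periodic_config (w : config) : Prop :=
  exists v : site, v != 0 /\ periodic w v.

(* Two linearly independent periods.  With a single period the density need not
   exist, and defects along a line leave it unchanged, so that infinitely many
   such maximal independent configurations have density 1/3 (or 1/7). *)
Definition doubly_periodic_config (w : config) : Prop :=
  exists u v : site,
    [/\ u.1 * v.2 - u.2 * v.1 != 0, periodic w u & periodic w v].

Definition occupied (w : config) (n : nat) : nat :=
  (\sum_(1 <= x < n.+1) \sum_(1 <= y < n.+1) w (x%:Z, y%:Z))%N.

Definition box_density (R : realType) (w : config) (n : nat) : R :=
  (occupied w n)%:R / (n ^ 2)%:R.

(* Meaningful only when [box_density R w] converges. *)
Definition density (R : realType) (w : config) : R :=
  limn (box_density R w).

(* Main.v *)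
(** A translation of the window changes the number of ones in an n x n window
    by O(n) only, so averaging the number of ones in s + P over s gives |P|
    times the density.  A triangle holds at most one occupied site and a closed
    neighbourhood at least one, whence 1/3 and 1/7.  For a configuration with
    periods (N, 0) and (0, N) the averages over an N x N window are exact, so
    equality forces exactly one occupied site in every triangle (in every
    closed neighbourhood).  In the first case w is invariant under (1, 1) and
    (2, -1), hence it is a class of x + 2y mod 3.  In the second case, if s is
    occupied then s + (1, 1) can only be covered by s + (2, 1) or s + (1, 2);
    this choice of a knight move propagates to its six rotations, and from
    there to all of w, which is a class of x + 5y or of x + 3y mod 7. *)
Require Import Defs.
From HB Require Import structures.
From mathcomp Require Import all_boot all_order all_algebra.
From mathcomp Require Import all_classical all_reals all_analysis.
From mathcomp Require Import zify ring lra.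

Set Implicit Arguments.
Unset Strict Implicit.
Unset Printing Implicit Defensive.

Import Order.TTheory GRing.Theory Num.Theory.
Import numFieldNormedType.Exports.
Local Open Scope classical_set_scope.
Local Open Scope ring_scope.

Lemma site_eq (s t : site) : s.1 = t.1 -> s.2 = t.2 -> s = t.
Proof. by case: s t => [? ?] [? ?] /= -> ->. Qed.

(** The two basis vectors generate the group of sites, so claims about translations reduce to unit
    shifts. *)
Lemma site_closure_ind (P : site -> Prop) :
  P (1, 0) -> P (0, 1) -> (forall d e, P d -> P e -> P (d + e)) ->
  (forall d, P d -> P (- d)) -> forall d, P d.
Proof.
move=> P10 P01 PD PN.
have P0 : P 0 by rewrite -(subrr (1, 0)); apply: PD => //; apply: PN.
have PM e (k : int) : P e -> P (e *~ k).
  move=> Pe; elim/int_ind: k => [|n|n] //.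
  - by rewrite intS mulrzDr mulr1z => ?; apply: PD.
  - rewrite !mulrNz intS mulrzDr mulr1z opprD => ?.
    by apply: PD => //; apply: PN.
move=> d.
have -> : d = (1, 0) *~ d.1 + (0, 1) *~ d.2.
  apply: site_eq; rewrite /= !raddfMz /= mul0rz ?addr0 ?add0r intz//.
by apply: PD; apply: PM.
Qed.

(** * Window sums, pattern counts and density *)

Section windows.
Variable R : realType.
Implicit Types (w : config) (n : nat) (a d s : site) (P : seq site).

Definition window w n a : R :=
  \sum_(x < n) \sum_(y < n) (w (a + (x%:Z, y%:Z)))%:R.

Definition count_in w P s : R := \sum_(d <- P) (w (s + d))%:R.

Lemma occupied_window w n : (occupied w n)%:R = window w n (1, 1).
Proof.
rewrite /occupied big_add1 /= big_mkord natr_sum; apply: eq_bigr => x _.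
rewrite big_add1 /= big_mkord natr_sum; apply: eq_bigr => y _.
by rewrite /GRing.add /=/add_pair/= !intS.
Qed.

(** Telescoping in the first coordinate leaves only the entering and the leaving column. *)
Lemma window_shift1 w n a :
  window w n (a + (1, 0)) - window w n a =
  \sum_(y < n) ((w (a + (n%:Z, y%:Z)))%:R - (w (a + (0, y%:Z)))%:R).
Proof.
rewrite /window -sumrB.
pose F (x : nat) : R := \sum_(y < n) (w (a + (x%:Z, y%:Z)))%:R.
transitivity (\sum_(0 <= x < n) (F x.+1 - F x)).
  rewrite big_mkord; apply: eq_bigr => x _; congr (_ - _).
  apply: eq_bigr => y _; congr (w _)%:R; rewrite -addrA; congr (_ + _).
by rewrite telescope_sumr // /F -sumrB.
Qed.

Lemma window_shift2 w n a :
  window w n (a + (0, 1)) - window w n a =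
  \sum_(x < n) ((w (a + (x%:Z, n%:Z)))%:R - (w (a + (x%:Z, 0)))%:R).
Proof.
rewrite /window -sumrB; apply: eq_bigr => x _; rewrite -sumrB.
pose F (y : nat) : R := (w (a + (x%:Z, y%:Z)))%:R.
transitivity (\sum_(0 <= y < n) (F y.+1 - F y)).
  rewrite big_mkord; apply: eq_bigr => y _; congr (_ - _).
  by congr (w _)%:R; rewrite -addrA; congr (_ + _).
by rewrite telescope_sumr.
Qed.

(** A unit shift exchanges one side of length [n] for another, and constants add up along sums of
    generators. Uniformity in [a] lets shifts be composed. *)
Lemma window_shift_bound w d :
  exists C : R, forall n a, `|window w n (a + d) - window w n a| <= C * n%:R.
Proof.
have boolB (b c : bool) : `|b%:R - c%:R : R| <= 1.
  by case: b c => [] []; rewrite ?subrr ?subr0 ?sub0r ?normrN ?normr1 ?normr0.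
have sumB n (F : 'I_n -> R) : (forall i, `|F i| <= 1) ->
    `|\sum_i F i| <= 1 * n%:R.
  move=> F1; apply: (le_trans (ler_norm_sum _ _ _)).
  apply: (le_trans (ler_sum _ (fun i _ => F1 i))).
  by rewrite sumr_const card_ord mul1r.
elim/site_closure_ind: d => [||d e [C HC] [C' HC']|d [C HC]].
- by exists 1 => n a; rewrite window_shift1; apply: sumB => i; exact: boolB.
- by exists 1 => n a; rewrite window_shift2; apply: sumB => i; exact: boolB.
- exists (C' + C) => n a; rewrite addrA mulrDl.
  by rewrite -(subrKA (window w n (a + d))) (le_trans (ler_normD _ _))// lerD.
- by exists C => n a; rewrite distrC -[X in window w n X - _](subrK d a) HC.
Qed.

(** The entering side is the leaving one moved by a period, so the boundary terms cancel. *)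
Lemma window_periodic w n : periodic w (n%:Z, 0) -> periodic w (0, n%:Z) ->
  forall a d, window w n (a + d) = window w n a.
Proof.
move=> p1 p2 a d; elim/site_closure_ind: d a => [||d e Pd Pe|d Pd] a.
- apply/eqP; rewrite -subr_eq0 window_shift1 big1// => y _.
  rewrite (_ : (n%:Z, y%:Z) = (0, y%:Z) + (n%:Z, 0)) ?addrA ?p1 ?subrr//.
  by apply: site_eq; rewrite /= ?add0r ?addr0.
- apply/eqP; rewrite -subr_eq0 window_shift2 big1// => x _.
  rewrite (_ : (x%:Z, n%:Z) = (x%:Z, 0) + (0, n%:Z)) ?addrA ?p2 ?subrr//.
  by apply: site_eq; rewrite /= ?add0r ?addr0.
- by rewrite addrA Pe Pd.
- by rewrite -(Pd (a - d)) subrK.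
Qed.

Lemma sum_count_in w P n a :
  \sum_(x < n) \sum_(y < n) count_in w P (a + (x%:Z, y%:Z)) =
  \sum_(d <- P) window w n (a + d).
Proof.
rewrite /window [RHS]exchange_big /=; apply: eq_bigr => x _.
rewrite [RHS]exchange_big /=; apply: eq_bigr => y _.
by apply: eq_bigr => d _; rewrite addrAC.
Qed.

Lemma sum_count_in_bound w P :
  exists C : R, forall n,
    `|\sum_(x < n) \sum_(y < n) count_in w P ((1, 1) + (x%:Z, y%:Z)) -
      (size P)%:R * (occupied w n)%:R| <= C * n%:R.
Proof.
elim: P => [|d P [C HC]].
  exists 0 => n; rewrite !mul0r subr0 big1 ?normr0// => x _.
  by rewrite big1// => y _; rewrite /count_in big_nil.
have [C' HC'] := window_shift_bound w d.
exists (C' + C) => n; move: (HC n) (HC' n (1, 1)).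
rewrite !sum_count_in big_cons /= -natr1 -occupied_window => h1 h2.
rewrite mulrDl mul1r opprD [- _ - _]addrC addrACA.
by rewrite (le_trans (ler_normD _ _))// mulrDl lerD.
Qed.


Definition mean_count w P n : R :=
  (\sum_(x < n) \sum_(y < n) count_in w P ((1, 1) + (x%:Z, y%:Z))) /
  (n ^ 2)%:R.

(** By double counting, the counts add up to [size P] times the window sum, up to boundary terms of
    order [n] that vanish after division by [n ^ 2]. *)
Lemma mean_count_gap w P :
  mean_count w P n - (size P)%:R * box_density R w n @[n --> \oo] --> 0.
Proof.
have [C HC] := sum_count_in_bound w P.
have cvC : C * harmonic n @[n --> \oo] --> 0.
  by rewrite -(mulr0 C); apply: cvgM; [exact: cvg_cst|exact: cvg_harmonic].
(* [harmonic n] is [1 / (n + 1)], so the comparison is made after a shift by one. *)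
apply: norm_cvg0; rewrite -cvg_shiftS.
apply: (squeeze_cvgr _ (cvg_cst 0) cvC); near=> n.
 rewrite /= normr_ge0 /= /mean_count /box_density mulrA -mulrBl.
  rewrite normrM normfV normr_nat natrX expr2 invfM mulrA.
  rewrite ler_pM2r ?invr_gt0 ?ltr0n//.
  by rewrite ler_pdivrMr ?ltr0n.
Unshelve. all: by end_near. Qed.

Lemma mean_count_ge w P (m : R) n : (forall s, m <= count_in w P s) ->
  (0 < n)%N -> m <= mean_count w P n.
Proof.
move=> H n0; rewrite ler_pdivlMr ?ltr0n ?expn_gt0 ?n0//.
rewrite natrX expr2 mulrA mulr_natr -[X in _ *+ X]card_ord -sumr_const.
rewrite ler_sum// => x _.
by rewrite mulr_natr -[X in _ *+ X]card_ord -sumr_const ler_sum.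
Qed.

Lemma mean_count_le w P (m : R) n : (forall s, count_in w P s <= m) ->
  (0 < n)%N -> mean_count w P n <= m.
Proof.
move=> H n0; rewrite ler_pdivrMr ?ltr0n ?expn_gt0 ?n0//.
rewrite natrX expr2 mulrA mulr_natr -[X in _ *+ X]card_ord -sumr_const.
rewrite ler_sum// => x _.
by rewrite mulr_natr -[X in _ *+ X]card_ord -sumr_const ler_sum.
Qed.

Lemma density_ge w P (m : R) : (0 < size P)%N ->
  (forall s, m <= count_in w P s) ->
  cvgn (box_density R w) -> m / (size P)%:R <= density R w.
Proof.
move=> P0 H cv; rewrite ler_pdivrMr ?ltr0n// mulrC.
have /(cvgB (cvg_cst m)) := mean_count_gap w P; rewrite subr0 => h.
apply: (ler_cvg_to h (cvgM (cvg_cst ((size P)%:R : R)) cv)).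
near=> n; rewrite /= opprB addrCA ler_wnDr// subr_le0.
by apply: mean_count_ge => //; near: n; exists 1%N.
Unshelve. all: by end_near. Qed.

Lemma density_le w P (m : R) : (0 < size P)%N ->
  (forall s, count_in w P s <= m) ->
  cvgn (box_density R w) -> density R w <= m / (size P)%:R.
Proof.
move=> P0 H cv; rewrite ler_pdivlMr ?ltr0n// mulrC.
have /(cvgB (cvg_cst m)) := mean_count_gap w P; rewrite subr0 => h.
apply: (ler_cvg_to (cvgM (cvg_cst ((size P)%:R : R)) cv) h).
near=> n; rewrite /= opprB addrCA ler_wpDr// subr_ge0.
by apply: mean_count_le => //; near: n; exists 1%N.
Unshelve. all: by end_near. Qed.

Lemma cvg_density w P (m : R) : (0 < size P)%N ->
  (forall s, count_in w P s = m) ->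
  box_density R w @ \oo --> m / (size P)%:R.
Proof.
move=> P0 H; have P0' : (size P)%:R != 0 :> R by rewrite pnatr_eq0 -lt0n.
have /(cvgB (cvg_cst m)) := mean_count_gap w P; rewrite subr0 => h.
apply: cvg_trans (cvgM h (cvg_cst ((size P)%:R^-1 : R))).
apply: near_eq_cvg; near=> n; rewrite !fctE /=.
have -> : mean_count w P n = m.
  have n0 : (0 < n)%N by near: n; exists 1%N.
  by apply/le_anti; rewrite mean_count_le ?mean_count_ge// => s; rewrite H.
by rewrite /= opprB addrC subrK mulrAC divff ?mul1r.
Unshelve. all: by end_near. Qed.

Lemma density_cst w P (m : R) : (0 < size P)%N ->
  (forall s, count_in w P s = m) -> density R w = m / (size P)%:R.
Proof. by move=> P0 H; apply: cvg_lim => //; exact: cvg_density. Qed.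

Lemma density_periodic w N : (0 < N)%N ->
  periodic w (N%:Z, 0) -> periodic w (0, N%:Z) ->
  cvgn (box_density R w) /\
  forall a, density R w = window w N a / (N ^ 2)%:R.
Proof.
move=> N0 p1 p2.
(* With this pattern every count is the same window sum. *)
pose P := [seq (x%:Z, y%:Z) : site | x <- iota 0 N, y <- iota 0 N].
have sP : size P = (N ^ 2)%N by rewrite size_allpairs size_iota.
have P0 : (0 < size P)%N by rewrite sP expn_gt0 N0.
have cP s : count_in w P s = window w N s.
  rewrite /count_in /window big_allpairs_dep -/(index_iota 0 N).
  rewrite -[N in iota 0 N]subn0 -/(index_iota 0 N) big_mkord.
  by apply: eq_bigr => x _; rewrite big_mkord.
have wP s : count_in w P s = window w N 0.
  by rewrite cP -(add0r s) window_periodic.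
split; first exact: cvgP (cvg_density P0 wP).
by move=> a; rewrite (density_cst P0 wP) sP -(cP a) wP.
Qed.

(** Over a full period the average is exact: the deviations from [m] have one sign and sum to zero,
    hence all vanish. *)
Lemma density_extremal w P N (m : R) : (0 < size P)%N -> (0 < N)%N ->
  periodic w (N%:Z, 0) -> periodic w (0, N%:Z) ->
  (forall s, m <= count_in w P s) \/ (forall s, count_in w P s <= m) ->
  density R w = m / (size P)%:R -> forall s, count_in w P s = m.
Proof.
move=> P0 N0 p1 p2 ext dm s.
have [_ dw] := density_periodic N0 p1 p2.
have E : \sum_(x < N) \sum_(y < N) (count_in w P (s + (x%:Z, y%:Z)) - m) = 0.
  under eq_bigr do rewrite sumrB.
  rewrite sumrB sum_count_in.
  under eq_bigr do rewrite (window_periodic p1 p2).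
  rewrite !sumr_const !card_ord big_const_seq count_predT iter_addr_0.
  have : window w N s / (N ^ 2)%:R = m / (size P)%:R by rewrite -(dw s).
  move/eqP; rewrite eqr_div ?pnatr_eq0 ?expn_eq0 -?lt0n ?N0//; last first.
    by rewrite negb_and -lt0n N0.
  by move=> /eqP; rewrite mulr_natr => ->; rewrite -mulrnA mulr_natr subrr.
have := E.
rewrite pair_big /=; case: ext => ext.
- move/eqP; rewrite psumr_eq0 => [/allP|[x y] _]; last by rewrite subr_ge0.
  (* The corner of the window based at [s] is [s] itself. *)
  move/(_ (Ordinal N0, Ordinal N0)); rewrite mem_index_enum => /(_ isT) /=.
  by rewrite addr0 subr_eq0 => /eqP.
- move/(congr1 -%R); rewrite oppr0 -sumrN => /eqP.
  rewrite psumr_eq0 => [/allP|[x y] _]; last by rewrite oppr_ge0 subr_le0.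
  move/(_ (Ordinal N0, Ordinal N0)); rewrite mem_index_enum => /(_ isT) /=.
  by rewrite addr0 oppr_eq0 subr_eq0 => /eqP.
Qed.

End windows.

(** * Adjacency in coordinates and the local form of maximal independence *)

Definition units : seq site :=
  [:: (1, 0); (0, 1); (-1, 1); (-1, 0); (0, -1); (1, -1)].
Definition nbhd : seq site := 0 :: units.
Definition up_triangle : seq site := [:: 0; (1, 0); (0, 1)].
Definition down_triangle : seq site := [:: 0; (-1, 0); (0, -1)].

(** The form is the squared Euclidean length; four times it is [(2x + y)^2 + 3y^2], which confines
    [y], and by symmetry [x], to -1, 0, 1. *)
Lemma hex_norm_eq1 (x y : int) :
  (x * x + x * y + y * y == 1) = ((x, y) \in units).
Proof.
apply/eqP/idP => [h|]; last first.
  by rewrite !inE !xpair_eqE => /or4P[|||/or3P[]] /andP[/eqP-> /eqP->].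
have hx : -1 <= x <= 1 by nia.
have hy : -1 <= y <= 1 by nia.
have {hx} : x \in [:: -1; 0; 1] by rewrite !inE; lia.
have {hy} : y \in [:: -1; 0; 1] by rewrite !inE; lia.
by rewrite !inE => /or3P[] /eqP yE /or3P[] /eqP xE; move: h; rewrite xE yE.
Qed.

Lemma adjacentE (R : realType) (s t : site) :
  Defs.adjacent R s t <-> t - s \in units.
Proof.
rewrite [t - s]surjective_pairing -hex_norm_eq1 /Defs.adjacent /eucl_dist.
rewrite big_ord_recl big_ord1 !mxE /=.
set X := _ + _; set N := (X in X == 1).
have -> : X = N%:~R.
  rewrite /X /N /= !rmorphD !rmorphM /= !rmorphB /=.
  have s3 : (Num.sqrt 3 : R) * Num.sqrt 3 = 3 by rewrite -expr2 sqr_sqrtr.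
  move: (Num.sqrt 3 : R) s3 => r s3.
  move: (s.1%:~R : R) (s.2%:~R : R) (t.1%:~R : R) (t.2%:~R : R) => x y z u.
  transitivity ((x + y / 2 - (z + u / 2)) ^+ 2 + ((y - u) / 2) ^+ 2 * (r * r)).
    by field.
  by rewrite s3; field.
split=> [h|/eqP ->]; last by rewrite sqrtr1.
have N0 : 0 <= N.
  rewrite /N; move: (t.1 - s.1) (t.2 - s.2) => x y.
  by have := sqr_ge0 (2 * x + y); have := sqr_ge0 y; nra.
move/(congr1 (fun z => z ^+ 2)): h; rewrite sqr_sqrtr ?ler0z// expr1n => /eqP.
by rewrite -[1]/(1%:~R) eqr_int.
Qed.

Lemma unitsN d : (- d \in units) = (d \in units).
Proof.
case: d => x y; rewrite -!hex_norm_eq1 /=.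
by rewrite !mulrNN.
Qed.

Definition packed (w : config) :=
  forall s d, d \in units -> w s -> w (s + d) = false.

Definition dominating (w : config) :=
  forall s, exists2 d, d \in nbhd & w (s + d).

(** Maximality can be tested on one added site: a site whose closed neighbourhood is empty could be
    adjoined. *)
Lemma max_indepP (R : realType) (w : config) :
  max_indep_configs R w <-> packed w /\ dominating w.
Proof.
split=> [[ind mx]|[ind dom]].
- split=> [s d du ws|s].
    apply/negbTE/negP => wsd; apply: (ind s (s + d)) => //.
    by apply/adjacentE; rewrite addrC addKr.
  have [[d du wd]|nd] := pselect (exists2 d, d \in nbhd & w (s + d)).
    by exists d.
  have E : [set t | w t] `|` [set s] = [set t | w t].
    apply: mx; last by move=> t; left.
    move=> t u [wt|->] [wu|->] /adjacentE.
    - by move/(adjacentE R); exact: (ind t u).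
    - move=> st; apply: nd; exists (t - s).
        by rewrite inE -unitsN opprB st orbT.
      by rewrite addrC subrK.
    - move=> us; apply: nd; exists (u - s); first by rewrite inE us orbT.
      by rewrite addrC subrK.
    - by rewrite subrr.
  have : ([set t | w t] `|` [set s]) s by right.
  by rewrite E => ws; exists 0; rewrite ?mem_head ?addr0.
- split=> [s t ws wt /adjacentE st|B indB wB].
    by have := ind s _ st ws; rewrite addrC subrK wt.
  apply/seteqP; split => // s Bs /=.
  have [d] := dom s; rewrite inE => /predU1P[->|du wd]; first by rewrite addr0.
  case: (indB s (s + d)) => //; first exact: wB.
  by apply/adjacentE; rewrite addrC addKr.
Qed.

(** Turns inclusion into equality: in the classification it suffices that [w] contains one residue
    class. *)
Lemma packed_max (R : realType) (v w : config) :
  max_indep_configs R v -> packed w -> (forall s, v s -> w s) -> w = v.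
Proof.
move=> /max_indepP[_ dom] pw vw; apply/funext => s.
have [vs|nvs] := boolP (v s); first exact: vw.
have [d] := dom s; rewrite inE => /predU1P[->|du /vw wd].
  by rewrite addr0 (negbTE nvs).
by have := pw _ _ _ wd; move=> /(_ (- d)); rewrite unitsN addrK => ->.
Qed.

Section counts.
Variable R : realType.
Implicit Types (w : config) (s d e : site) (P : seq site).

Lemma count_in_nat w P s : count_in R w P s = 
  (count (fun d => w (s + d)) P)%:R.
Proof.
rewrite /count_in -sum1_count natr_sum [RHS]big_mkcond.
by apply: eq_bigr => d _; case: (w _).
Qed.

Lemma dominating_count w s : dominating w -> 1 <= count_in R w nbhd s.
Proof.
by move=> /(_ s) dom; rewrite count_in_nat ler1n -has_count; apply/hasP.
Qed.

Lemma packed_count w P s :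
  all2rel (fun d e => (d == e) || (e - d \in units)) P -> uniq P ->
  packed w -> count_in R w P s <= 1.
Proof.
move=> /allrelP PP uP pw; rewrite count_in_nat lern1 -size_filter.
case E : [seq d <- P | w (s + d)] => [|d [|e r]] //.
have := filter_uniq (fun d => w (s + d)) uP; rewrite E /= inE negb_or.
rewrite -andbA => /andP[de _].
have : d \in [seq d <- P | w (s + d)] by rewrite E mem_head.
have : e \in [seq d <- P | w (s + d)] by rewrite E !inE eqxx orbT.
rewrite !mem_filter => /andP[we Pe] /andP[wd Pd].
have := PP _ _ Pd Pe; rewrite (negbTE de) => /(pw (s + d)) /(_ wd).
by rewrite addrACA subrr addr0 we.
Qed.

End counts.

(** * Periods of a configuration *)

Lemma periodicD (w : config) u v :
  periodic w u -> periodic w v -> periodic w (u + v).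
Proof. by move=> pu pv s; rewrite addrA pv pu. Qed.

Lemma periodicN (w : config) u : periodic w u -> periodic w (- u).
Proof. by move=> pu s; rewrite -(pu (s - u)) subrK. Qed.

Lemma periodicMz (w : config) u (k : int) : periodic w u -> periodic w (u *~ k).
Proof.
move=> pu; have pn (n : nat) : periodic w (u *+ n).
  by elim: n => [|n IH] s; rewrite ?addr0 // mulrS; exact: periodicD.
case: k => n; first exact: pn.
by apply: periodicN; exact: pn.
Qed.

Lemma periodic_homo (w : config) u : (forall s, w s -> w (s + u)) ->
  (forall s, w s -> w (s - u)) -> periodic w u.
Proof. by move=> h h' s; apply/idP/idP => [/h'|/h//]; rewrite addrK. Qed.

Lemma site_mulz (x y k : int) : ((x, y) : site) *~ k = (x * k, y * k).
Proof. by apply: site_eq; rewrite raddfMz /= mulrzz. Qed.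

(** Cramer's rule: the determinant times either basis vector is an integer combination of the two
    periods. *)
Lemma doubly_periodic_box (w : config) : doubly_periodic_config w ->
  exists N : nat, [/\ (0 < N)%N, periodic w (N%:Z, 0) & periodic w (0, N%:Z)].
Proof.
move=> [[u1 u2] [[v1 v2] [/= D0 pu pv]]].
set D := u1 * v2 - u2 * v1 in D0 *.
exists (absz D); split; first by rewrite absz_gt0.
(* The sign [e] turns the determinant into its absolute value. *)
all: rewrite abszEsign; set e := (-1) ^+ _; rewrite /D.
- rewrite (_ : (_, _) = ((u1, u2) *~ v2 - (v1, v2) *~ u2) *~ e).
    by apply/periodicMz/periodicD; [|apply/periodicN]; exact: periodicMz.
  by rewrite !site_mulz; apply: site_eq => /=; ring.
- rewrite (_ : (_, _) = ((v1, v2) *~ u1 - (u1, u2) *~ v1) *~ e).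
    by apply/periodicMz/periodicD; [|apply/periodicN]; exact: periodicMz.
  by rewrite !site_mulz; apply: site_eq => /=; ring.
Qed.

(** * Residue classes of a linear form modulo [m] *)

Section linear_configs.
Variable m : nat.
Hypothesis m_gt1 : (1 < m)%N.
Implicit Types (a k : 'Z_m) (s t : site).

Definition residue a s : 'Z_m := s.1%:~R + a * s.2%:~R.
Definition linear_config a k : config := fun s => residue a s == k.

Lemma residueD a s t : residue a (s + t) = residue a s + residue a t.
Proof. by rewrite /residue /= !intrD mulrDr addrACA. Qed.

Lemma linear_configD a k s t :
  linear_config a k (s + t) = (residue a t == k - residue a s).
Proof. by rewrite /linear_config residueD [RHS]eq_sym subr_eq addrC eq_sym. Qed.

Lemma linear_config_periodic a k u : residue a u = 0 ->
  periodic (linear_config a k) u.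
Proof. by move=> u0 s; rewrite /linear_config residueD u0 addr0. Qed.

Lemma intr_modulus : m%:Z%:~R = 0 :> 'Z_m.
Proof. exact: pchar_Zp m_gt1. Qed.

Lemma linear_config_doubly_periodic a k :
  doubly_periodic_config (linear_config a k).
Proof.
exists (m%:Z, 0), (0, m%:Z); split => /=.
- by rewrite mul0r subr0 mulf_neq0//; lia.
- apply: linear_config_periodic.
  by rewrite /residue /= intr_modulus !rmorph0 ?mulr0 ?addr0.
- apply: linear_config_periodic.
  by rewrite /residue /= intr_modulus !rmorph0 ?mulr0 ?addr0.
Qed.

Lemma linear_config_max_indep (R : realType) a k :
  all (fun d => residue a d != 0) units ->
  (forall c, has (fun d => residue a d == c) nbhd) ->
  max_indep_configs R (linear_config a k).
Proof.
move=> /allP indep dom; apply/max_indepP; split=> [s d du /eqP sk|s].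
  by rewrite linear_configD sk subrr (negbTE (indep d du)).
have /hasP[d dn dk] := dom (k - residue a s).
by exists d; rewrite ?linear_configD.
Qed.

(** [P] represents each residue once, so every translate of [P] meets the class in one site. *)
Lemma linear_config_density (R : realType) a k P : (0 < size P)%N ->
  (forall c, count (fun d => residue a d == c) P = 1%N) ->
  density R (linear_config a k) = 1 / (size P)%:R.
Proof.
move=> P0 h; apply: density_cst => // s; rewrite count_in_nat.
by under eq_count do rewrite linear_configD; rewrite h.
Qed.

(** The site [(k, 0)] recovers the class; then [(k - a, 1)], of residue [k], recovers the
    multiplier. *)
Lemma linear_config_inj a a' k k' :
  linear_config a k = linear_config a' k' -> a = a' /\ k = k'.
Proof.
move=> E.
have res (b x : 'Z_m) (y : int) : residue b ((x : nat)%:Z, y) = x + b * y%:~R.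
  by rewrite /residue /=; congr (_ + _); exact: natr_Zp.
have kk : k = k'.
  have := congr1 (fun w : config => w ((k : nat)%:Z, 0)) E.
  by rewrite /linear_config !res !mulr0 !addr0 eqxx => /esym/eqP.
split=> //; subst k'.
have := congr1 (fun w : config => w (Posz (k - a)%R, 1)) E.
rewrite /linear_config !res !mulr1 subrK eqxx => /esym/eqP/eqP.
by rewrite addrAC subr_eq => /eqP/addrI.
Qed.

Lemma intr_Zp_eq0 (z : int) : z%:~R = 0 :> 'Z_m -> exists q, z = q * m%:Z.
Proof.
move=> z0; exists (z %/ m)%Z; rewrite {1}(divz_eq z m).
have : (0 <= z %% m)%Z by rewrite modz_ge0// -lt0n ltnW.
have : (z %% m < m%:Z)%Z by rewrite ltz_pmod// ltz_nat ltnW.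
have : ((z %% m)%Z)%:~R = 0 :> 'Z_m.
  by move: z0; rewrite {1}(divz_eq z m) intrD intrM intr_modulus mulr0 add0r.
case: (z %% m)%Z => // r r0; rewrite ltz_nat => rm _.
have /(congr1 val) : r%:R = 0 :> 'Z_m by exact: r0.
by rewrite /= val_Zp_nat// modn_small// => ->; rewrite addr0.
Qed.

(** The kernel of the residue map is generated by [(m, 0)] and [(- a, 1)]. *)
Lemma periodic_residue_eq (w : config) (a : int) s t :
  periodic w (m%:Z, 0) -> periodic w (- a, 1) ->
  residue a%:~R s = residue a%:~R t -> w s = w t.
Proof.
move=> p1 p2 /eqP; rewrite -subr_eq0 => /eqP.
rewrite /residue -!intrM -!intrD -intrB => /intr_Zp_eq0[q qE].
rewrite -[RHS](periodicD (periodicMz q p1) (periodicMz (s.2 - t.2) p2)).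
congr (w _); rewrite !site_mulz; apply: site_eq => /=; last by ring.
by rewrite (mulrC m%:Z) -qE; ring.
Qed.

End linear_configs.

(** * Patterns met exactly once, and rigidity of the triangle case *)

Implicit Types (w : config) (s t c d e k : site) (P K T : seq site).

Definition exactly_one P (w : config) :=
  forall s, count (fun d => w (s + d)) P = 1%N.

Lemma count_in_exactly_one (R : realType) w P :
  (forall s, count_in R w P s = 1) -> exactly_one P w.
Proof.
by move=> h s; apply/eqP; have /eqP := h s; rewrite count_in_nat pnatr_eq1.
Qed.

Lemma exactly_one_mem w P s : exactly_one P w ->
  exists2 d, d \in P & w (s + d).
Proof. by move=> /(_ s) c1; apply/hasP; rewrite has_count c1. Qed.

Lemma exactly_one_uniq w P s d e : uniq P -> exactly_one P w ->
  d \in P -> e \in P -> w (s + d) -> w (s + e) -> d = e.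
Proof.
move=> uP /(_ s); rewrite -size_filter => c1 Pd Pe wd we.
have : d \in [seq d <- P | w (s + d)] by rewrite mem_filter wd.
have : e \in [seq d <- P | w (s + d)] by rewrite mem_filter we.
case: [seq d <- P | w (s + d)] c1 => [|a []]//= _.
by rewrite !inE => /eqP-> /eqP->.
Qed.

Lemma packed_forced w P s c t : packed w -> exactly_one P w ->
  all (fun d => (c + d == t) || (c + d \in units)) P -> w s -> w (s + t).
Proof.
move=> pw oP /allP ok ws; have [d dP] := exactly_one_mem (s + c) oP.
rewrite -addrA; case/orP: (ok d dP) => [/eqP-> //|cu].
by rewrite (pw _ _ cu ws).
Qed.

Lemma exactly_one_triangles_linear (R : realType) w :
  max_indep_configs R w ->
  exactly_one up_triangle w -> exactly_one down_triangle w ->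
  exists k : 'Z_3, w = linear_config 2 k.
Proof.
move=> /max_indepP[pw dw] oU oD; have [s _ ws] := dw 0; rewrite add0r in ws.
(* A triangle with two vertices adjacent to an occupied site forces the third; opposite directions
   use opposite orientations. *)
have p11 : periodic w (1, 1).
  apply: periodic_homo => t.
    exact: (packed_forced (c := (1, 1)) pw oD).
  exact: (packed_forced (c := (-1, -1)) pw oU).
have p21 : periodic w (2, -1).
  apply: periodic_homo => t.
    exact: (packed_forced (c := (1, -1)) pw oU).
  exact: (packed_forced (c := (-1, 1)) pw oD).
exists (residue 2 s); apply: (packed_max (R := R)) => //.
  by apply: linear_config_max_indep => //; case=> [[|[|[|//]]] i].
(* The kernel generators are [(3, 0) = (1, 1) + (2, -1)] and [(-2, 1) = - (2, -1)]. *)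
move=> t /eqP Et; rewrite (@periodic_residue_eq 3 isT w 2 t s)//.
  exact: (periodicD p11 p21).
exact: (periodicN p21).
Qed.

(** * Perfect domination and knight moves *)

(* The closed neighbourhoods of [s] and [t] meet; [s + d] is the common site. *)
Definition overlap (s t : site) := has (fun d => t - (s + d) \in nbhd) nbhd.

Lemma nbhdN d : (- d \in nbhd) = (d \in nbhd).
Proof. by rewrite in_cons [RHS]in_cons oppr_eq0 unitsN. Qed.

(** Otherwise the common site would be covered twice. *)
Lemma perfect_overlap w s k t : exactly_one nbhd w -> overlap k t ->
  w (s + k) -> w (s + t) -> k = t.
Proof.
move=> ow /hasP[d dn tn] wk wt; apply: (addIr (- (k + d))).
apply: (exactly_one_uniq (s := s + (k + d)) _ ow) => //.
- by rewrite opprD addNKr nbhdN.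
- by rewrite addrACA subrr addr0.
- by rewrite addrACA subrr addr0.
Qed.

(** Some site covers [s + c]; candidates overlapping a different known occupied site from [K] are
    excluded, which leaves [T]. The hypothesis is a finite check. *)
Lemma perfect_forced w s K c T : exactly_one nbhd w ->
  all (fun d => (c + d \in T) ||
    has (fun k => (k != c + d) && overlap k (c + d)) K) nbhd ->
  all (fun k => w (s + k)) K -> has (fun t => w (s + t)) T.
Proof.
move=> ow /allP ok /allP wK; have [d dn] := exactly_one_mem (s + c) ow.
rewrite -addrA => wd; apply/hasP.
case/orP: (ok d dn) => [cT|/hasP[k kK /andP[/eqP kd ov]]].
  by exists (c + d).
by case: kd; exact: perfect_overlap ow ov (wK k kK) wd.
Qed.

(* Clockwise rotation by 60 degrees. *)
Definition turn (s : site) : site := (s.1 + s.2, - s.1).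
Definition reflect_if (b : bool) (s : site) : site :=
  if b then s else (s.2, s.1).
(** The twelve sites at squared distance 7 form two rotation orbits; [b] is the chirality, [false]
    giving the mirror images. *)
Definition knight b i := reflect_if b (iter i turn (2, 1)).

Lemma turn3 s : iter 3 turn s = - s.
Proof. by apply: site_eq => /=; ring. Qed.

Lemma knightD3 b i : knight b (i + 3) = - knight b i.
Proof. by rewrite /knight addnC iterD turn3; case: b. Qed.

Lemma knight_modulo b i n : knight b (i + n * 6) = knight b i.
Proof.
elim: n => [|n IH]; first by rewrite addn0.
by rewrite mulSnr addnA -[6%N]/(3 + 3)%N addnA !knightD3 opprK.
Qed.

Lemma perfect_turn w s b i : exactly_one nbhd w ->
  w s -> w (s + knight b i) -> w (s + knight b i.+1).
Proof.
move=> ow ws; rewrite (divn_eq i 6) addnC -addSn !knight_modulo => wi.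
suff : has (fun t => w (s + t)) [:: knight b (i %% 6).+1] by rewrite /= orbF.
(* With [s] as origin and move [(2, 1)], the site [(2, -1)] is covered by neither; every candidate
   to cover it except the next move [(3, -2)] overlaps one of them. *)
apply: (perfect_forced (K := [:: 0; knight b (i %% 6)])
  (c := reflect_if b (iter (i %% 6) turn (2, -1)))) => //.
  have := ltn_pmod i (isT : 0 < 6)%N.
  by case: b {wi} (i %% 6)%N => [] [|[|[|[|[|[|]]]]]].
by rewrite /= addr0 ws wi.
Qed.

Lemma perfect_linear (R : realType) w :
  max_indep_configs R w -> exactly_one nbhd w ->
  exists b (k : 'Z_7), w = linear_config (if b then 5 else 3) k.
Proof.
move=> mw ow; have [pw dw] := (max_indepP R w).1 mw.
have [s _ ws] := dw 0; rewrite add0r in ws.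
have [b wb] : exists b, w (s + knight b 0).
  have : has (fun t => w (s + t)) [:: knight true 0; knight false 0].
    apply: (perfect_forced (K := [:: 0]) (c := (1, 1))) => //.
    by rewrite /= addr0 ws.
  by rewrite /= orbF => /orP[]; [exists true | exists false].
have turns t i j : w t -> w (t + knight b i) -> w (t + knight b (i + j)).
  move=> wt wi; elim: j => [|j IH]; first by rewrite addn0.
  by rewrite addnS; exact: perfect_turn.
(* Recording the chirality makes the predicate invariant under the moves. *)
pose Q t := w t && w (t + knight b 0).
have QD t i : Q t -> Q (t + knight b i).
  move=> /andP[wt w0]; have wi := turns t 0%N i wt w0; apply/andP; split=> //.
  (* The reverse move [i + 3] leads back to [t]; turning it [5 * (i + 3)] more times gives index
     [6 * (i + 3)], that is [knight b 0]. *)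
  have := turns (t + knight b i) (i + 3)%N (5 * (i + 3))%N wi.
  rewrite -mulSn mulnC -[(_ * _)%N]add0n knight_modulo; apply.
  by rewrite knightD3 addrK.
have Qp i : periodic Q (knight b i).
  by apply: periodic_homo => t; rewrite -?knightD3; exact: QD.
exists b, (residue (if b then 5 else 3) s); apply: (packed_max (R := R)) => //.
  apply: linear_config_max_indep => //; case: (b) => //;
    by case=> [[|[|[|[|[|[|[|//]]]]]]] i].
move=> t /eqP Et; suff /andP[] : Q t by [].
rewrite (_ : Q t = Q s); first by rewrite /Q ws wb.
have p0 := Qp 0%N; have p1 := Qp 1%N; case: (b) Et p0 p1 => Et p0 p1.
(* The moves are [(2, 1)] and [(3, -2)]: twice the first plus the second is [(7, 0)], minus their
   sum is [(-5, 1)]. *)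
- apply: (@periodic_residue_eq 7 isT Q 5) => //.
    exact: (periodicD (periodicD p0 p0) p1).
  exact: (periodicN (periodicD p0 p1)).
(* The moves are [(1, 2)] and [(-2, 3)]: three times the first minus twice the second is [(7, 0)],
   the second minus the first is [(-3, 1)]. *)
- apply: (@periodic_residue_eq 7 isT Q 3) => //.
    exact: (periodicD (periodicD p0 (periodicD p0 p0))
      (periodicN (periodicD p1 p1))).
  exact: (periodicD p1 (periodicN p0)).
Qed.

(** * Classification and count of the extremal configurations *)

Lemma card_range_inj (T : finType) (U : Type) (f : T -> U) : injective f ->
  (range f #= `I_#|T|)%card.
Proof.
move=> f_inj; apply: card_eq_trans (inj_card_eq (in2W f_inj)) _.
rewrite card_eq_sym; apply: card_eq_trans card_II _.
rewrite card_eq_sym -(_ : range (enum_val : 'I_#|T| -> T) = setT).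
  exact: inj_card_eq (in2W enum_val_inj).
by apply/seteqP; split=> // x _; exists (enum_rank x) => //; exact: enum_rankK.
Qed.

Section extremal_densities.
Variable R : realType.

Lemma packed_up_triangle_le1 w s : packed w -> count_in R w up_triangle s <= 1.
Proof. exact: packed_count. Qed.

Lemma packed_down_triangle_le1 w s :
  packed w -> count_in R w down_triangle s <= 1.
Proof. exact: packed_count. Qed.

Lemma max_indep_density w : max_indep_configs R w ->
  cvgn (box_density R w) -> 1 / 7 <= density R w <= 1 / 3.
Proof.
move=> /max_indepP[pw dw] cv; apply/andP; split.
  by apply: (density_ge (P := nbhd)) => // s; exact: dominating_count.
apply: (density_le (P := up_triangle)) => // s.
exact: packed_up_triangle_le1.
Qed.

Lemma density_third_linear w : max_indep_configs R w ->
  doubly_periodic_config w -> density R w = 1 / 3 ->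
  exists k : 'Z_3, w = linear_config 2 k.
Proof.
move=> mw /doubly_periodic_box[N [N0 p1 p2]] dw.
have [pw _] := (max_indepP R w).1 mw.
apply: (exactly_one_triangles_linear mw); apply: (@count_in_exactly_one R).
- apply: (density_extremal _ N0 p1 p2) => //.
  by right=> s; exact: packed_up_triangle_le1.
- apply: (density_extremal _ N0 p1 p2) => //.
  by right=> s; exact: packed_down_triangle_le1.
Qed.

Lemma density_seventh_linear w : max_indep_configs R w ->
  doubly_periodic_config w -> density R w = 1 / 7 ->
  exists b (k : 'Z_7), w = linear_config (if b then 5 else 3) k.
Proof.
move=> mw /doubly_periodic_box[N [N0 p1 p2]] dw.
have [_ domw] := (max_indepP R w).1 mw.
apply: (perfect_linear mw); apply: (@count_in_exactly_one R).
apply: (density_extremal _ N0 p1 p2) => //.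
by left=> s; exact: dominating_count.
Qed.

Lemma linear_config_third (k : 'Z_3) :
  [/\ max_indep_configs R (linear_config 2 k),
      doubly_periodic_config (linear_config 2 k)
    & density R (linear_config 2 k) = 1 / 3].
Proof.
split.
- by apply: linear_config_max_indep => //; case=> [[|[|[|//]]] i].
- exact: linear_config_doubly_periodic.
- apply: (@linear_config_density 3 R _ _ up_triangle) => //.
  by case=> [[|[|[|//]]] i].
Qed.

Lemma linear_config_seventh b (k : 'Z_7)
    (w := linear_config (if b then 5 else 3) k) :
  [/\ max_indep_configs R w, doubly_periodic_config w & density R w = 1 / 7].
Proof.
split.
- apply: linear_config_max_indep => //; case: b {w} => //;
    by case=> [[|[|[|[|[|[|[|//]]]]]]] i].
- exact: linear_config_doubly_periodic.
- apply: (@linear_config_density 7 R _ _ nbhd) => //; case: b {w};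
    by case=> [[|[|[|[|[|[|[|//]]]]]]] i].
Qed.

End extremal_densities.

Unset Implicit Arguments.

Theorem theorem3 (R : realType) :
  [/\ forall w : config, max_indep_configs R w -> periodic_config w ->
        cvgn (box_density R w) -> 1 / 7 <= density R w <= 1 / 3,
      forall w : config, max_indep_configs R w -> doubly_periodic_config w ->
        cvgn (box_density R w) /\ 1 / 7 <= density R w <= 1 / 3,
      ([set w : config | [/\ max_indep_configs R w, doubly_periodic_config w
                           & density R w = 1 / 3]] #= `I_3)%card
    & ([set w : config | [/\ max_indep_configs R w, doubly_periodic_config w
                           & density R w = 1 / 7]] #= `I_14)%card].
Proof.
split=> [w mw _|w mw dw||].
- exact: max_indep_density.
- have [N [N0 p1 p2]] := doubly_periodic_box dw.
  have [cv _] := density_periodic R N0 p1 p2.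
  by split=> //; exact: max_indep_density.
- rewrite (_ : [set _ | _] = range (@linear_config 3 2)).
    have := @card_range_inj 'Z_3 _ (@linear_config 3 2).
    rewrite card_ord; apply.
    by move=> k k' /linear_config_inj[].
  apply/seteqP; split=> [w [mw dw]|_ [k _ <-]]; last exact: linear_config_third.
  by move=> /(density_third_linear mw dw)[k ->]; exists k.
(* Two chiralities with seven classes each give 14; they stay distinct because 5 and 3 differ modulo
   7. *)
- pose f (p : bool * 'Z_7) := linear_config (if p.1 then 5 else 3) p.2.
  rewrite (_ : [set _ | _] = range f).
    have := @card_range_inj (bool * 'Z_7)%type _ f.
    rewrite card_prod card_bool card_ord; apply.
    by move=> [b k] [b' k'] /linear_config_inj[]; case: b b' => [] [] //= _ ->.
  apply/seteqP; split=> [w [mw dw]|_ [[b k] _ <-]]; last first.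
    exact: linear_config_seventh.
  by move=> /(density_seventh_linear mw dw)[b [k ->]]; exists (b, k).
Qed.
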